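(* Define a sequence $a_{nr}$, for $n\in\mathbb N$ and $r\in I(n)$, by \begin{align*} a_{nn}&=1 &&\text{for all }n,\\ a_{n0}&=(n-1)!! &&\text{if $n$ is even},\\ a_{nr}&=a_{n-1,r-1}+(n-r)\,a_{n-2,r} &&\text{if }1\le r\le n-2. \end{align*} For $n\in\mathbb N$ and $r=n-2k\in I(n)$ put $\rho_{nr}=\binom nr(2k-1)!!=\frac{n!}{2^k\,k!\,r!}$. Then for any $n\in\mathbb N$ and $r\in I(n)$: (i) $e(R_\alpha(\mathcal B_n))=e(L_\alpha(\mathcal B_n))=a_{nr}$ for any $\alpha\in D_r(\mathcal B_n)$; (ii) $e(D_r(\mathcal B_n))=\rho_{nr}\,a_{nr}$; (iii) $e(\mathcal B_n)=\sum_{r\in I(n)}\rho_{nr}\,a_{nr}$.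
   Context: $\mathbb N=\{0,1,2,\dots\}$ and $I(n)=\{r\in\{0,1,\dots,n\}: n-r \text{ is even}\}$. For odd $k$, $k!!=k(k-2)\cdots 3\cdot 1$, with $(-1)!!=1$. Write $\mathbf n=\{1,\dots,n\}$ and let $\mathbf n'$ be a disjoint copy. The Brauer monoid $\mathcal B_n$ is the set of all set partitions $\alpha$ of $\mathbf n\cup\mathbf n'$ into blocks of size exactly $2$ ($\mathcal B_0=\{\emptyset\}$). Product: for $\alpha,\beta\in\mathcal B_n$ take a third copy $\mathbf n''$; relabel each lower vertex $x'$ of $\alpha$ as $x''$ and each upper vertex $x$ of $\beta$ as $x''$, and take the union graph $\Gamma(\alpha,\beta)$ on $\mathbf n\cup\mathbf n'\cup\mathbf n''$ (blocks being viewed as edges); $x,y\in\mathbf n\cup\mathbf n'$ are in the same block of $\alpha\beta$ iff they are joined by a path in $\Gamma(\alpha,\beta)$. The rank of $\alpha$ is the number of blocks meeting both $\mathbf n$ and $\mathbf n'$, and $D_r(\mathcal B_n)=\{\alpha\in\mathcal B_n:\operatorname{rank}(\alpha)=r\}$. For $\alpha\in\mathcal B_n$ let $\Lambda^\wedge(\alpha)$ be the graph on $\mathbf n$ with an edge $\{i,j\}$ for each block $\{i,j\}\subseteq\mathbf n$ of $\alpha$, and $\Lambda_\vee(\alpha)$ the graph on $\mathbf n$ with an edge $\{i,j\}$ for each block $\{i',j'\}\subseteq\mathbf n'$ of $\alpha$. Put $R_\alpha(\mathcal B_n)=\{\beta\in\mathcal B_n:\Lambda^\wedge(\beta)=\Lambda^\wedge(\alpha)\}$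 and $L_\alpha(\mathcal B_n)=\{\beta\in\mathcal B_n:\Lambda_\vee(\beta)=\Lambda_\vee(\alpha)\}$; these are the $\mathscr R$- and $\mathscr L$-classes of $\alpha$ in $\mathcal B_n$ (Green's relations). For $\Sigma\subseteq\mathcal B_n$, $e(\Sigma)$ is the number of $\alpha\in\Sigma$ with $\alpha^2=\alpha$. *)

(* Defs.v *)
From mathcomp Require Import all_boot.

Set Implicit Arguments.
Unset Strict Implicit.
Unset Printing Implicit Defensive.

(* k!! is only used at odd arguments k >= -1. The value at 0 is 1, so that with
   truncated predecessor the convention (-1)!! = 1 is [dfact 0.-1 = 1]. *)
Fixpoint dfact (k : nat) : nat := if k is j.+2 then k * dfact j else 1.

Definition Iset (n : nat) : seq nat := [seq r <- iota 0 n.+1 | ~~ odd (n - r)].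

(* Only meaningful for r in Iset n: there, the last branch is reached exactly
   when 1 <= r <= n - 2. *)
Fixpoint a_ (n r : nat) {struct n} : nat :=
  if r == n then 1
  else if r == 0 then dfact n.-1
  else if n is (m.+1 as n1).+1 then a_ n1 r.-1 + (n - r) * a_ m r
  else 0.

Lemma a_nn n : a_ n n = 1.
Proof. by case: n => [|n] //=; rewrite eqxx. Qed.

Lemma a_n0 n : ~~ odd n -> a_ n 0 = dfact n.-1.
Proof. by case: n. Qed.

Lemma a_rec n r : 1 <= r -> r <= n - 2 ->
  a_ n r = a_ n.-1 r.-1 + (n - r) * a_ (n - 2) r.
Proof.
case: n => [|[|n]]; first by case: r.
  by case: r.
rewrite subn2 [_.-2]/= => r_gt0 r_le.
have /negPf r_neq : r != n.+2 by rewrite neq_ltn ltnS (leq_trans r_le).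
by rewrite [LHS]/= r_neq gtn_eqF.
Qed.

(* With r = n - 2k, the number (n - r)./2 is k. *)
Definition rho (n r : nat) : nat := 'C(n, r) * dfact ((n - r)./2.*2).-1.

(* The vertex set n \cup n': [inl x] is the upper vertex x, [inr x] the lower
   vertex x'. *)
Definition vertex (n : nat) : finType := ('I_n + 'I_n)%type.

Definition brauer (n : nat) : {set {set {set vertex n}}} :=
  [set al | partition al [set: vertex n] & [forall B in al, #|B| == 2]].

(* The vertex set n \cup n' \cup n'': the outer vertices are [inl v] with
   v : vertex n, and [inr x] is the middle vertex x''. *)
Definition vertex3 (n : nat) : finType := (vertex n + 'I_n)%type.

Definition embed_top n (v : vertex n) : vertex3 n :=
  match v with inl x => inl (inl x) | inr x => inr x end.

Definition embed_bot n (v : vertex n) : vertex3 n :=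
  match v with inl x => inr x | inr x => inl (inr x) end.

Definition Gamma_edges n (al be : {set {set vertex n}}) : {set {set vertex3 n}} :=
  [set (@embed_top n) @: (B : {set vertex n}) | B in al]
  :|: [set (@embed_bot n) @: (B : {set vertex n}) | B in be].

Definition Gamma n (al be : {set {set vertex n}}) : rel (vertex3 n) :=
  [rel u v | [set u; v] \in Gamma_edges al be].

Definition bmul n (al be : {set {set vertex n}}) : {set {set vertex n}} :=
  equivalence_partition
    (fun x y : vertex n => connect (Gamma al be) (inl x) (inl y))
    [set: vertex n].

Definition rank n (al : {set {set vertex n}}) : nat :=
  #|[set B in al | [exists i : 'I_n, inl i \in B]
                   && [exists j : 'I_n, inr j \in B]]|.

Definition Dclass (n r : nat) : {set {set {set vertex n}}} :=
  [set al in brauer n | rank al == r].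

(* The graphs on {1..n} are represented by their edge sets. *)
Definition Lambda_up n (al : {set {set vertex n}}) : {set {set 'I_n}} :=
  [set e : {set 'I_n} | (@inl _ _ @: e : {set vertex n}) \in al].

Definition Lambda_low n (al : {set {set vertex n}}) : {set {set 'I_n}} :=
  [set e : {set 'I_n} | (@inr _ _ @: e : {set vertex n}) \in al].

Definition Rclass n (al : {set {set vertex n}}) : {set {set {set vertex n}}} :=
  [set be in brauer n | Lambda_up be == Lambda_up al].

Definition Lclass n (al : {set {set vertex n}}) : {set {set {set vertex n}}} :=
  [set be in brauer n | Lambda_low be == Lambda_low al].

Definition idem_count n (S : {set {set {set vertex n}}}) : nat :=
  #|[set al in S | bmul al al == al]|.

(* Main.v *)
Require Import Defs.
From mathcomp Require Import all_boot.
From mathcomp Require Import perm ring.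

(** A Brauer diagram is a fixed-point-free involution of its 2n vertices
    ([partner]).  Its upper blocks give an involution u of {0, .., n-1} moving
    the points covered by them, its lower blocks an involution v ([upper] and
    [lower]); the transversals are a bijection from the fixed points of u to
    those of v.  When the diagram is squared, the middle row of the product
    graph is the union of the matchings u and v, a graph with paths and cycles
    as components ([interface]); the ends of the paths are the fixed points of
    u and of v, where a transversal leaves the middle row.

    If a path had both ends fixed by u (or both fixed by v), squaring would
    create a new lower (upper) block.  So in an idempotent every path has one
    end of each kind ([separated]), and then squaring preserves the transversal
    at x exactly when it leads to the other end of the path of x.  Hence the
    transversals of an idempotent are determined by u and v, and conversely
    every separated pair (u, v) extends to an idempotent: idempotents of the
    Brauer monoid correspond to separated pairs ([idem_separated],
    [idem_partner], [joined_idem]).  That a path with one end fixed by u does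
    have an end fixed by v comes from parity: a stable set and the fixed points
    of an involution in it have cardinals of the same parity
    ([odd_card_fixed]).

    Being separated is symmetric in u and v, so R-classes and L-classes lead to
    the same count: given u with r fixed points, how many v are separated from
    u ([card_separated])?  If r = 0, exactly the v without fixed points.
    Otherwise let x be a fixed point of u.  Either v fixes x, and x can be
    deleted; or v x = j, and j cannot be fixed by u, since x -- j would be a
    path with two ends fixed by u.  There are n - r such j, and for each of them
    the path x -- j -- u j -- ... can be shortened to u j -- ... by deleting
    x and j ([separated_unpair]).  This is the recurrence of a_{n,r}.  A D-class
    is the union of the R-classes indexed by the involutions u with r fixed
    points, of which there are rho_{n,r} ([card_invols_fixed]). *)

Set Implicit Arguments.
Unset Strict Implicit.
Unset Printing Implicit Defensive.

(** * Involutions supported on a set *)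

Section Involutions.
Variable T : finType.
Implicit Types (A C F : {set T}) (u v : {ffun T -> T}) (x y j k : T).

Definition invols A : {set {ffun T -> T}} :=
  [set v : {ffun T -> T} |
    [forall z, (v (v z) == z) && ((z \in A) || (v z == z))]].

Definition fixed (u : T -> T) : {set T} := [set x | u x == x].

Lemma involsP A v :
  reflect (involutive v /\ forall z, z \notin A -> v z = z) (v \in invols A).
Proof.
rewrite inE; apply: (iffP forallP) => [v_inv | [vK vA] z].
  split=> z; first by case/andP: (v_inv z) => /eqP.
  by case/andP: (v_inv z) => _ /orP[-> // | /eqP].
by rewrite vK eqxx; case: (boolP (z \in A)) => //= /vA ->.
Qed.

Lemma involsT v : (v \in invols [set: T]) <-> involutive v.
Proof.
split=> [/involsP[] // | vK]; apply/involsP; split=> // z.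
by rewrite inE.
Qed.

Lemma invols_stable A v x : v \in invols A -> x \in A -> v x \in A.
Proof.
case/involsP=> vK vA xA; apply: contraLR xA => vxA.
by rewrite -(vK x) (vA _ vxA).
Qed.

Lemma invols_id : [ffun x => x] \in invols set0.
Proof. by apply/involsP; split=> z; rewrite !ffunE. Qed.

Lemma invols0 : invols set0 = [set [ffun x => x]].
Proof.
apply/setP=> v; rewrite [in RHS]inE; apply/idP/eqP => [/involsP[_ v0] | ->].
  by apply/ffunP=> z; rewrite ffunE v0 ?inE.
exact: invols_id.
Qed.

(** The points that the involution moves come in pairs {x, u x}. *)
Lemma odd_card_fixed (u : T -> T) C :
  involutive u -> {in C, forall x, u x \in C} ->
  odd #|C| = odd #|C :&: fixed u|.
Proof.
move=> uK; have [m] := ubnP #|C|; elim: m C => // m IH C le_m uC.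
have [|[x /setDP[xC]]] := set_0Vmem (C :\: fixed u).
  by move/eqP; rewrite setD_eq0 => /setIidPl ->.
rewrite inE => ux; have uxC : u x \in C :\ x by rewrite !inE ux uC.
have cardC : #|C| = #|C :\ x :\ u x|.+2.
  by rewrite (cardsD1 x) xC (cardsD1 (u x)) uxC.
have -> : C :&: fixed u = (C :\ x :\ u x) :&: fixed u.
  apply/setP=> z; rewrite !inE; case: (eqVneq z x) => [->|_].
    by rewrite (negPf ux) !andbF.
  by case: (eqVneq z (u x)) => [->|] //; rewrite uK eq_sym (negPf ux) !andbF.
rewrite cardC /= negbK; apply: IH; first by apply: ltnW; rewrite -ltnS -cardC.
move=> z; rewrite !inE => /and3P[zux zx zC].
by rewrite uC // andbT (inj_eq (inv_inj uK)) zx (can2_eq uK uK) zux.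
Qed.

(** * Components of the union of two matchings *)

(** The loops at fixed points are harmless: only reachability matters. *)
Definition interface u v : rel T := [rel a b | (u a == b) || (v a == b)].

Definition linked u v : rel T := connect (interface u v).

Lemma linkedC u v : linked u v =2 linked v u.
Proof. by apply: eq_connect => a b; rewrite /interface /= orbC. Qed.

Lemma linked_sym u v :
  involutive u -> involutive v -> symmetric (linked u v).
Proof.
move=> uK vK; apply: sym_connect_sym => a b; rewrite /interface /=.
by rewrite (can2_eq uK uK) (can2_eq vK vK) ![_ == a]eq_sym ![a == _]eq_sym.
Qed.

Lemma linked_refl u v : reflexive (linked u v).
Proof. exact: connect0. Qed.

Lemma linked_trans u v : transitive (linked u v).
Proof. exact: connect_trans. Qed.

Lemma linked_u u v a : linked u v a (u a).
Proof. by apply: connect1; rewrite /interface /= eqxx. Qed.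

Lemma linked_v u v a : linked u v a (v a).
Proof. by apply: connect1; rewrite /interface /= eqxx orbT. Qed.

Lemma linked_ind u v (S : eqType) (f : T -> S) :
  (forall a, f (u a) = f a) -> (forall a, f (v a) = f a) ->
  forall a b, linked u v a b -> f a = f b.
Proof.
move=> fu fv a b /connectP[p]; elim: p a => [|c p IH] a /= => [_ -> //|].
by case/andP=> /orP[]/eqP <- /IH h /h <-.
Qed.

(** Each component is a path or a cycle; this says that no path has both of its
    ends fixed by u, or both fixed by v. *)
Definition separated u v : bool :=
  [forall a, forall b, linked u v a b ==>
    ((a \in fixed u) && (b \in fixed u) || (a \in fixed v) && (b \in fixed v))
    ==> (a == b)].

Lemma separatedP u v :
  reflect (forall a b, linked u v a b ->
             u a = a /\ u b = b \/ v a = a /\ v b = b -> a = b)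
          (separated u v).
Proof.
apply: (iffP forallP) => [H a b lab fab | H a].
  move/forallP/(_ b): (H a); rewrite lab !inE /= => /implyP h.
  by apply/eqP/h; case: fab => [] [-> ->]; rewrite !eqxx ?orbT.
apply/forallP=> b; apply/implyP=> lab; apply/implyP; rewrite !inE => fab.
apply/eqP/H => //.
by case/orP: fab => /andP[/eqP ? /eqP ?]; [left | right].
Qed.

Lemma separatedC u v : separated u v = separated v u.
Proof.
by apply/separatedP/separatedP=> H a b lab [] fab; apply: H;
  rewrite 1?linkedC //; [right | left | right | left].
Qed.

(** For a fixed point x of u, the other end of the path that starts at x. *)
Definition far u v x : T := odflt x [pick y in fixed v | linked u v x y].

(** The component C of x is stable under u and v, so #|C| has the parity of the
    number of fixed points of u in C, and also of v.  The first number is 1, as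
    u and v are separated; so the second is not 0. *)
Lemma far_spec u v x : involutive u -> involutive v -> separated u v ->
  u x = x -> v (far u v x) = far u v x /\ linked u v x (far u v x).
Proof.
move=> uK vK /separatedP sep ux; rewrite /far.
case: pickP => [y /andP[] | none] /=; first by rewrite inE => /eqP.
pose C := [set b | linked u v x b].
have C_stable b w : linked u v b w -> b \in C -> w \in C.
  by rewrite !inE => lbw lxb; apply: connect_trans lbw.
have Cu : C :&: fixed u = [set x].
  apply/setP=> b; rewrite !inE; apply/andP/eqP => [[lxb /eqP ub]|->].
    by apply/esym/sep; auto.
  by rewrite ux eqxx; split=> //; apply: connect0.
have Cv : C :&: fixed v = set0.
  apply/setP=> b; rewrite !inE.
  by have /= := none b; rewrite inE andbC.
have := odd_card_fixed vK (fun b => C_stable b _ (linked_v u v b)).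
by rewrite (odd_card_fixed uK (fun b => C_stable b _ (linked_u u v b))) Cu Cv
           cards1 cards0.
Qed.

Lemma far_unique u v x y : involutive u -> involutive v -> separated u v ->
  u x = x -> v y = y -> linked u v x y -> far u v x = y.
Proof.
move=> uK vK sep ux vy lxy; have [vf lxf] := far_spec uK vK sep ux.
move/separatedP: sep; apply; last by right.
by apply: linked_trans lxy; rewrite (linked_sym uK vK).
Qed.

Lemma farK u v x : involutive u -> involutive v -> separated u v ->
  u x = x -> far v u (far u v x) = x.
Proof.
move=> uK vK sep ux; have [vf lxf] := far_spec uK vK sep ux.
apply: far_unique; rewrite // 1?separatedC // linkedC.
by rewrite (linked_sym uK vK).
Qed.

(** * Shortening a path by two vertices *)

(** When v exchanges x and j, this makes both of them fixed points.  Writing it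
    with a transposition makes it an involution on all functions, hence a
    bijection usable for counting. *)
Definition unpair x j v : {ffun T -> T} := [ffun z => v (tperm x j z)].

Lemma unpairK x j : involutive (unpair x j).
Proof. by move=> v; apply/ffunP=> z; rewrite !ffunE tpermK. Qed.

Lemma unpairE x j v z : v x = j -> v j = x ->
  unpair x j v z = if (z == x) || (z == j) then z else v z.
Proof.
move=> vx vj; rewrite ffunE; case: tpermP => [->|->|/eqP/negPf-> /eqP/negPf->] //=.
  by rewrite eqxx.
by rewrite eqxx orbT.
Qed.

Lemma unpair_invols A x j v : x \in A -> j \in A -> x != j ->
  (unpair x j v \in invols (A :\ x :\ j)) = (v \in invols A) && (v x == j).
Proof.
move=> xA jA xj; have jx : j != x by rewrite eq_sym.
apply/idP/andP => [/involsP[wK wA] | [/involsP[vK vA] /eqP vx]].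
  have wx : v j = x by have := wA x; rewrite !ffunE tpermL !inE eqxx andbF; apply.
  have wj : v x = j by have := wA j; rewrite !ffunE tpermR !inE eqxx; apply.
  split; last by rewrite wj.
  apply/involsP; split=> z.
    case: (eqVneq z x) => [->|zx]; first by rewrite wj.
    case: (eqVneq z j) => [->|zj]; first by rewrite wx.
    have := wK z; rewrite !(unpairE _ wj wx) (negPf zx) (negPf zj) /=.
    by case: (eqVneq (v z) x) => [-> /= /esym/eqP|_ /=]; rewrite ?(negPf zx) //;
       case: (eqVneq (v z) j) => [-> /= /esym/eqP|_ /=]; rewrite ?(negPf zj).
  move=> zA; have zx : z != x by apply: contraNneq zA => ->.
  have zj : z != j by apply: contraNneq zA => ->.
  have := wA z; rewrite (unpairE _ wj wx) (negPf zx) (negPf zj) /=; apply.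
  by rewrite !inE (negPf zA) !andbF.
have vj : v j = x by rewrite -vx vK.
apply/involsP; split=> z; last first.
  rewrite (unpairE _ vx vj) !inE; case: (eqVneq z j) => [|_]; first by rewrite orbT.
  by case: (eqVneq z x) => //= _ /vA.
rewrite !(unpairE _ vx vj); case zxj: ((z == x) || (z == j)); rewrite ?zxj //.
case/norP: (negbT zxj) => zx zj.
by rewrite (can2_eq vK vK) vx (negPf zj) (can2_eq vK vK) vj (negPf zx) /= vK.
Qed.

Lemma card_by_image A (S : {set {ffun T -> T}}) x :
  S \subset invols A -> x \in A ->
  #|S| = \sum_(j in A) #|[set v in S | v x == j]|.
Proof.
move=> /subsetP SA xA; rewrite -sum1_card.
rewrite (partition_big (fun v : {ffun T -> T} => v x) (mem A)) => [|v /SA vA].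
  by apply: eq_bigr => j _; rewrite -sum1_card; apply: eq_bigl => v; rewrite inE.
exact: invols_stable vA xA.
Qed.

Definition perfect_matchings A : {set {ffun T -> T}} :=
  [set v in invols A | fixed v == ~: A].

(** A point x has #|A| - 1 possible mates j, and unpairing x and j leaves a
    perfect matching of the other points. *)
Lemma card_perfect_matchings A : ~~ odd #|A| -> #|perfect_matchings A| = dfact #|A|.-1.
Proof.
have [m] := ubnP #|A|; elim: m A => // m IH A le_m evA.
have [-> | [x xA]] := set_0Vmem A.
  rewrite cards0 [RHS]/= -(cards1 [ffun x : T => x]); congr #|pred_of_set _|.
  apply/setP=> v; rewrite -invols0 [in LHS]inE.
  case: (boolP (v \in invols set0)) => //=; rewrite invols0 inE => /eqP ->.
  by apply/eqP/setP=> x; rewrite !inE ffunE eqxx.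
have cardA j : j \in A :\ x -> #|A| = #|A :\ x :\ j|.+2.
  by move=> jA; rewrite (cardsD1 x) xA (cardsD1 j) jA.
rewrite (@card_by_image A _ x) //; last by apply/subsetP=> v; rewrite inE; case/andP.
rewrite (bigD1 x) //= [X in X + _](_ : _ = 0) ?add0n; last first.
  apply/eqP; rewrite cards_eq0; apply/eqP/setP=> v; rewrite !inE.
  apply/negP=> /andP[/andP[_ /eqP/setP/(_ x)]]; rewrite !inE xA.
  by move=> ->.
rewrite (eq_bigr (fun=> dfact #|A|.-1.-2)) => [|j /andP[jA jx]].
  rewrite (eq_bigl (mem (A :\ x))) => [|j]; last by rewrite !inE andbC.
  rewrite sum_nat_const.
  have -> : #|A :\ x| = #|A|.-1 by rewrite [in RHS](cardsD1 x) xA.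
  case: (#|A|) evA (cardsD1 x A); rewrite ?xA // => -[//|c] _ _ /=.
  by case: c => [|c] //=; rewrite ?muln1.
have jAx : j \in A :\ x by rewrite !inE jx.
rewrite [in RHS](cardA _ jAx) -IH; last 2 first.
- by move: le_m; rewrite (cardA _ jAx) ltnS; apply: leq_trans.
- by move: evA; rewrite (cardA _ jAx) /= negbK.
rewrite -[RHS](card_preimset _ (inv_inj (unpairK x j))).
congr #|pred_of_set _|; apply/setP=> v; rewrite [in LHS]inE [in LHS]inE [in RHS]inE [in RHS]inE.
rewrite unpair_invols // 1?eq_sym //.
rewrite -!andbA; case: (boolP (v \in invols A)) => //= /involsP[vK _].
rewrite andbC; case: eqP => //= vx; have vj : v j = x by rewrite -vx vK.
apply/eqP/eqP => /setP fv; apply/setP=> z; have:= fv z; rewrite !inE !(unpairE _ vx vj).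
  by case: (eqVneq z x) => [->|] /=; rewrite ?eqxx ?andbF //; case: (eqVneq z j) => [->|] //=; rewrite eqxx.
case: (eqVneq z x) => [-> _|] /=; first by rewrite xA vx (negPf jx).
by case: (eqVneq z j) => [-> _ _|] //=; rewrite jA vj eq_sym (negPf jx).
Qed.

(** The path x -- j -- k -- ... starts at the fixed point x of u.  Unpairing x and
    j in v, and j and k in u, isolates x and j and leaves a path that starts
    at k. *)
Section Contraction.
Variables (u v : {ffun T -> T}) (x j k : T).
Hypotheses (uK : involutive u) (vK : involutive v).
Hypotheses (xj : x != j) (ux : u x = x) (vx : v x = j) (kj : k != j) (uj : u j = k).
Let u' := unpair j k u.
Let v' := unpair x j v.

Let vj : v j = x. Proof. by rewrite -vx vK. Qed.
Let uk : u k = j. Proof. by rewrite -uj uK. Qed.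
Let xk : x != k. Proof. by apply: contraNneq xj => xk; rewrite -ux {1}xk uk. Qed.

Let u'E z : u' z = if (z == j) || (z == k) then z else u z.
Proof. exact: unpairE. Qed.
Let v'E z : v' z = if (z == x) || (z == j) then z else v z.
Proof. exact: unpairE. Qed.

(* moves the start of the path from x to k, the start of the shorter path *)
Let collapse z := if (z == x) || (z == j) then k else z.

Lemma linked_unpair a b : linked u' v' a b -> linked u v a b.
Proof.
apply: connect_sub => {a b} a b /= /orP[]/eqP <-.
  by rewrite u'E; case: ifP => _; [apply: connect0 | apply: linked_u].
by rewrite v'E; case: ifP => _; [apply: connect0 | apply: linked_v].
Qed.

Lemma linked_collapse a b :
  linked u v a b -> linked u' v' (collapse a) (collapse b).
Proof.
case/connectP=> p; elim: p a => [|c p IH] a /= => [_ ->|]; first exact: linked_refl.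
case/andP=> ac /IH h /h; apply: linked_trans; rewrite /collapse.
case/orP: ac => /eqP <-.
  case: (eqVneq a x) => [->|ax] /=; first by rewrite ux eqxx linked_refl.
  case: (eqVneq a j) => [->|aj] /=.
    by rewrite uj; case: ifP => _; apply: linked_refl.
  case: (eqVneq a k) => [->|ak]; first by rewrite uk eqxx orbT linked_refl.
  rewrite !(can2_eq uK uK) ux uj (negPf ax) (negPf ak) /=.
  by have := linked_u u' v' a; rewrite u'E (negPf aj) (negPf ak).
case: (eqVneq a x) => [->|ax] /=; first by rewrite vx eqxx orbT linked_refl.
case: (eqVneq a j) => [->|aj] /=; first by rewrite vj eqxx linked_refl.
rewrite !(can2_eq vK vK) vx vj (negPf ax) (negPf aj) /=.
by have := linked_v u' v' a; rewrite v'E (negPf ax) (negPf aj).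
Qed.

(** Fixed points of v avoid x and j both before and after unpairing, up to the
    new isolated points; on the fixed points of u, exchanging the roles of x and
    k translates one condition into the other. *)
Lemma separated_unpair : separated (unpair j k u) (unpair x j v) = separated u v.
Proof.
have isol z a b : (z == x) || (z == j) -> linked u' v' a b -> (a == z) = (b == z).
  move=> zxj; apply: (@linked_ind u' v' _ (eq_op^~ z)) => c /=.
    rewrite u'E; case: ifP => //; case: (eqVneq c z) => [->|cz].
      by case/orP: zxj => /eqP ->; rewrite ?ux ?eqxx.
    case/norP=> cj ck; apply/negP; rewrite (can2_eq uK uK).
    by case/orP: zxj cz => /eqP ->; rewrite ?ux ?uj ?(negPf ck) // => /negPf ->.
  rewrite v'E; case: ifP => // /norP[cx cj].
  by case/orP: zxj => /eqP ->; rewrite (can2_eq vK vK) ?vx ?vj (negPf cx) (negPf cj).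
have ux' : u' x = x by rewrite u'E (negPf xj) (negPf xk) ux.
have uk' : u' k = k by rewrite u'E eqxx orbT.
have notk c : u c = c -> c != k by apply: contra_eqN => /eqP ->; rewrite uk eq_sym.
have notj c : u c = c -> c != j by apply: contra_eqN => /eqP ->; rewrite uj.
apply/separatedP/separatedP => sep a b lab fab.
  have [fu|fv] := fab; last first.
    have off c : v c = c -> ((c == x) || (c == j)) = false.
      by move=> vc; apply/negP=> /orP[]/eqP ec; move: vc xj; rewrite ec ?vx ?vj => ->;
        rewrite eqxx.
    case: fv => va vb; apply: sep; last first.
      by right; rewrite !v'E !off.
    by have := linked_collapse lab; rewrite /collapse !off.
  case: fu => ua ub.
  have fu' c : u c = c -> u' c = c by move=> uc; rewrite u'E uc; case: ifP.
  have off c : u c = c -> collapse c = if c == x then k else c.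
    by move=> uc; rewrite /collapse (negPf (notj _ uc)) orbF.
  have fc c : u c = c -> u' (collapse c) = collapse c.
    by move=> uc; rewrite (off _ uc); case: ifP => // _; apply: fu'.
  have := sep _ _ (linked_collapse lab); rewrite !fc // !off // => /(_ (or_introl (conj erefl erefl))).
  case: (eqVneq a x) => [->|_]; case: (eqVneq b x) => [->|_] //.
  - by move=> kb; move: (notk b ub); rewrite kb eqxx.
  - by move=> ak; move: (notk a ua); rewrite ak eqxx.
have [ax|ax] := eqVneq a x.
  by apply/esym/eqP; rewrite ax -(isol x a b) ?eqxx // ax.
have [aj|aj] := eqVneq a j.
  by apply/esym/eqP; rewrite aj -(isol j a b) ?eqxx ?orbT // aj.
have bx : b != x by rewrite -(isol x a b) ?eqxx.
have bj : b != j by rewrite -(isol j a b) ?eqxx ?orbT.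
have lab1 := linked_unpair lab.
have lkx : linked u v k x.
  by apply: (linked_trans (linked_u u v k)); rewrite uk -vj linked_v.
case: fab; rewrite ?v'E ?u'E ?(negPf ax) ?(negPf aj) ?(negPf bx) ?(negPf bj) /=; last first.
  by move=> fv; apply: sep; auto.
have lxx c d : u d = d -> linked u v c d -> c = k -> d = x.
  move=> ud lcd ck; apply/esym/sep; last by auto.
  by apply: linked_trans lcd; rewrite ck linked_sym.
case: (eqVneq a k) => ak; case: (eqVneq b k) => bk [ua ub].
- by rewrite ak bk.
- by rewrite (lxx _ _ ub lab1 ak) eqxx in bx.
- rewrite linked_sym // in lab1.
  by rewrite (lxx _ _ ua lab1 bk) eqxx in ax.
- by apply: sep; auto.
Qed.

End Contraction.

(** The bound r < n instead of r <= n - 2 avoids parity considerations in the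
    induction below. *)
Lemma aE n r : 0 < r -> r < n ->
  a_ n r = a_ n.-1 r.-1 + (n - r) * a_ (n - 2) r.
Proof.
case: n r => [|[|n]] [|r] //= _ lt_rn.
by rewrite (ltn_eqF lt_rn) subn2.
Qed.

(** * Counting separated involutions *)

Lemma linked_isolated u v a b : involutive u -> involutive v ->
  u a = a -> v a = a -> linked u v a b -> a = b.
Proof.
move=> uK vK ua va lab; apply/esym/eqP.
have <- : (a == a) = (b == a); last exact: eqxx.
apply: (@linked_ind u v _ (eq_op^~ a)) lab => c /=.
  by rewrite (can2_eq uK uK) ua.
by rewrite (can2_eq vK vK) va.
Qed.

(** The union of u with v has no ends fixed by u, so a path would have two ends
    fixed by v. *)
Lemma card_separated_matching A u : u \in perfect_matchings A ->
  #|[set v in invols A | separated u v]| = dfact #|A|.-1.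
Proof.
rewrite inE => /andP[uA /eqP fu]; have /involsP[uK _] := uA.
have evA : ~~ odd #|A|.
  rewrite (odd_card_fixed uK (fun z => @invols_stable A u z uA)) fu.
  by rewrite setICr cards0.
rewrite -card_perfect_matchings //; congr #|pred_of_set _|; apply/setP=> v.
rewrite [in LHS]inE [in RHS]inE; case: (boolP (v \in invols A)) => //= /involsP[vK vout].
apply/idP/eqP => [sep | fv].
  apply/setP=> z; rewrite !inE; apply/eqP/idP => [vz|/vout //].
  rewrite separatedC in sep.
  have [uf lzf] := far_spec vK uK sep vz.
  have fA : far v u z \notin A by rewrite -in_setC -fu inE uf.
  have <- // : far v u z = z.
  by apply: (@linked_isolated v u); rewrite // 1?linked_sym // vout.
apply/separatedP=> a b lab fab; have uva : (u a == a) = (v a == a).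
  by move/setP/(_ a): fu; move/setP/(_ a): fv; rewrite !inE => -> ->.
by apply: linked_isolated lab => //; apply/eqP; case: fab => [] [/eqP fa _];
  rewrite // ?uva // -uva.
Qed.

(** If v moved z, the edge z -- v z would join two fixed points of u. *)
Lemma separated_id v :
  separated [ffun x => x] v -> involutive v -> v = [ffun x => x].
Proof.
move/separatedP=> sep vK; apply/ffunP=> z; rewrite ffunE.
by apply/esym/sep; [apply: linked_v | left; rewrite !ffunE].
Qed.

(** Induction on A, by the image of a fixed point x of u under v.  Working with
    involutions supported on a set A, instead of involutions of a smaller type,
    is harmless since points outside A are isolated. *)
Lemma card_separated A u : u \in invols A ->
  #|[set v in invols A | separated u v]| = a_ #|A| #|A :&: fixed u|.
Proof.
have [m] := ubnP #|A|; elim: m A u => // m IH A u le_m uA.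
have /involsP[uK uout] := uA.
have [r0 | [x]] := set_0Vmem (A :&: fixed u).
  have uM : u \in perfect_matchings A.
    rewrite inE uA eqEsubset /=; apply/andP; split; apply/subsetP=> z; rewrite !inE.
      move=> uz; apply/negP=> zA; move/setP/(_ z): r0.
      by rewrite !inE zA uz.
    by move/uout/eqP.
  rewrite card_separated_matching // r0 cards0 a_n0 //.
  by rewrite (odd_card_fixed uK (fun z => @invols_stable A u z uA)) r0 cards0.
rewrite !inE => /andP[xA /eqP ux].
have r_gt0 : 0 < #|A :&: fixed u|.
  by apply/card_gt0P; exists x; rewrite !inE xA ux eqxx.
case: (eqVneq #|A :&: fixed u| #|A|) => [rn | rn].
  have uid : u = [ffun z => z].
    apply/ffunP=> z; rewrite ffunE; case: (boolP (z \in A)) => [|/uout //].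
    have /eqP <- : A :&: fixed u == A by rewrite eqEcard subsetIl rn /=.
    by rewrite !inE => /andP[_ /eqP].
  rewrite rn a_nn -(cards1 [ffun z : T => z]); congr #|pred_of_set _|.
  apply/setP=> v; rewrite [in LHS]inE [in RHS]inE.
  apply/andP/eqP => [[/involsP[vK _]]|->].
    by rewrite uid => /separated_id ->.
  rewrite uid in uA *; split=> //; apply/separatedP=> a b lab _.
  by apply: linked_isolated lab; do ?[move=> ?]; rewrite !ffunE.
have r_lt : #|A :&: fixed u| < #|A| by rewrite ltn_neqAle rn subset_leq_card ?subsetIl.
rewrite aE // (@card_by_image A _ x) //; last first.
  by apply/subsetP=> v; rewrite inE; case/andP.
rewrite (bigD1 x) //=; congr (_ + _).
  have invx w : (w \in invols (A :\ x)) = (w \in invols A) && (w x == x).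
    apply/involsP/andP => [[wK wA]|[/involsP[wK wA] /eqP wx]].
      split; last by rewrite wA // !inE eqxx.
      by apply/involsP; split=> // z zA; rewrite wA // !inE (negPf zA) andbF.
    split=> // z; rewrite !inE; case: (eqVneq z x) => [->|_] //=.
    exact: wA.
  have cA : #|A :\ x| = #|A|.-1 by rewrite [in RHS](cardsD1 x) xA.
  have cF : #|(A :\ x) :&: fixed u| = #|A :&: fixed u|.-1.
    rewrite [in RHS](cardsD1 x) !inE xA ux eqxx /=; congr #|pred_of_set _|.
    by apply/setP=> z; rewrite !inE andbA.
  rewrite -cA -cF -IH; last 2 first.
  - by rewrite cA; case: (#|A|) r_lt le_m.
  - by rewrite invx uA ux /=.
  congr #|pred_of_set _|; apply/setP=> v; rewrite [in LHS]inE [in RHS]inE invx.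
  by rewrite [in LHS]inE andbAC.
rewrite (bigID (mem (fixed u))) /= big1 ?add0n => [|j /andP[/andP[jA jx]]]; last first.
  (* x and j would be two linked fixed points of u *)
  rewrite inE => /eqP uj; apply/eqP; rewrite cards_eq0; apply/eqP/setP=> v.
  rewrite !inE; apply/negP=> /andP[/andP[_ /separatedP sep] /eqP vx].
  case/eqP: jx; rewrite -vx; apply/esym/sep; first exact: linked_v.
  by left; rewrite vx.
rewrite (eq_bigl (mem (A :\: fixed u))) => [|j]; last first.
  rewrite !inE andbC; case: (eqVneq j x) => [->|_]; last by rewrite andbT.
  by rewrite ux eqxx.
rewrite (eq_bigr (fun=> a_ (#|A| - 2) #|A :&: fixed u|)) => [|j].
  by rewrite sum_nat_const cardsD.
rewrite !inE => /andP[uj jA]; pose k := u j.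
have kj : k != j := uj.
have jx : j != x by apply: contraNneq uj => ->; rewrite ux.
have xj : x != j by rewrite eq_sym.
have uk : u k = j by rewrite /k uK.
have kx : k != x by apply: contraNneq xj => kx; rewrite -uk kx ux.
have kA : k \in A by apply: invols_stable.
have cA : #|A :\ x :\ j| = #|A| - 2.
  by rewrite [in RHS](cardsD1 x) xA (cardsD1 j (A :\ x)) !inE jx jA subn2.
have u'E z := @unpairE j k u z erefl uk.
have cF : #|(A :\ x :\ j) :&: fixed (unpair j k u)| = #|A :&: fixed u|.
  rewrite [LHS](cardsD1 k) [RHS](cardsD1 x) !inE u'E eqxx orbT kj kx kA xA ux !eqxx /=.
  congr (_ + _); congr #|pred_of_set _|; apply/setP=> z; rewrite !inE u'E.
  case: (eqVneq z j) => [->|zj] /=; first by rewrite (negPf uj) !andbF.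
  case: (eqVneq z k) => [->|zk] /=; first by rewrite uk (eq_sym j) (negPf kj) !andbF ?andFb.
  by rewrite andbA.
rewrite -cA -cF -IH; last 2 first.
- by rewrite cA; case: (#|A|) r_lt le_m => [|[|c]] //= _; rewrite subn2 /= !ltnS => /ltnW.
- apply/involsP; split=> z.
    rewrite !u'E; case zjk: ((z == j) || (z == k)); rewrite ?zjk //.
    case/norP: (negbT zjk) => zj zk.
    by rewrite (can2_eq uK uK) (negPf zk) (can2_eq uK uK) uk (negPf zj) /= uK.
  rewrite !inE !negb_and !negbK u'E; case/or3P=> [->//|/eqP ->|/uout ->]; last by case: ifP.
  by rewrite ux; case: ifP.
rewrite -[RHS](card_preimset _ (inv_inj (unpairK x j))).
congr #|pred_of_set _|; apply/setP=> v; rewrite [in LHS]inE [in LHS]inE [in RHS]inE [in RHS]inE.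
rewrite unpair_invols // andbAC.
case: (boolP (v \in invols A)) => //= /involsP[vK _]; case: eqP => //= vx.
by rewrite separated_unpair.
Qed.

(** Choose the fixed points, then a perfect matching of the others. *)
Lemma card_invols_fixed r : ~~ odd (#|T| - r) ->
  #|[set u in invols [set: T] | #|fixed u| == r]| = 'C(#|T|, r) * dfact (#|T| - r).-1.
Proof.
move=> ev; rewrite -sum1_card.
rewrite (partition_big (fun u : {ffun T -> T} => fixed u) (fun F => #|F| == r)) => [|u] /=; last first.
  by rewrite inE => /andP[].
rewrite (eq_bigr (fun=> dfact (#|T| - r).-1)) => [|F /eqP cF].
  rewrite -card_draws sum_nat_const; congr (_ * _).
  by apply: eq_card => F; rewrite inE.
have cFC : #|~: F| = #|T| - r by rewrite cardsCs setCK cF.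
rewrite -cFC -card_perfect_matchings ?cFC // -sum1_card; apply: eq_bigl => u.
rewrite !(in_set (fun u => _ && _)) setCK.
case: (eqVneq (fixed u) F) => [fu|_]; last by rewrite !andbF.
rewrite fu cF eqxx !andbT; apply/idP/involsP => [/involsT uK|[uK _]]; last exact/involsT.
by split=> // z; rewrite inE negbK -fu inE => /eqP.
Qed.

End Involutions.

(** * Partitions into pairs as fixed-point-free involutions *)

Section Pairings.
Variable W : finType.
Implicit Types (P : {set {set W}}) (p : W -> W).

Definition pairing P := partition P [set: W] && [forall B in P, #|B| == 2].

Definition partner P x := odflt x [pick y | (x != y) && ([set x; y] \in P)].

Definition pairs p := [set [set x; p x] | x : W].

Lemma set2_eq (a b c d : W) : [set a; b] = [set c; d] ->
  (a = c /\ b = d) \/ (a = d /\ b = c).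
Proof.
move=> E; have aE : a \in [set c; d] by rewrite -E set21.
have bE : b \in [set c; d] by rewrite -E set22.
have cE : c \in [set a; b] by rewrite E set21.
have dE : d \in [set a; b] by rewrite E set22.
case/set2P: aE cE dE => -> cE dE; case/set2P: bE cE dE => ->; auto.
  by rewrite setUid !inE => _ /eqP ->; auto.
by rewrite setUid !inE => /eqP ->; auto.
Qed.

Lemma pairing_mem P x y : pairing P ->
  ([set x; y] \in P) = (y == partner P x).
Proof.
case/andP=> partP /forall_inP card2; have [covP triv _] := and3P partP.
have uniqP z z' : [set x; z] \in P -> [set x; z'] \in P -> z = z'.
  move=> Pz Pz'; have : [set x; z] = [set x; z'].
    by rewrite -(def_pblock triv Pz (set21 x z)) (def_pblock triv Pz' (set21 x z')).
  by case/set2_eq=> [][] // <- ->.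
have off z : [set x; z] \in P -> x != z.
  by move=> Pz; apply: contraTneq (card2 _ Pz) => <-; rewrite setUid cards1.
rewrite /partner; case: pickP => [z /andP[xz Pz] | none] /=.
  by apply/idP/eqP => [Py | ->] //; apply: uniqP.
have Px : pblock P x \in P by rewrite pblock_mem // (eqP covP).
have xPx : x \in pblock P x by rewrite mem_pblock (eqP covP).
have /cards2P[a [b [ab defB]]] := card2 _ Px.
rewrite defB in Px xPx; case/set2P: xPx => def_x.
  by have := none b; rewrite def_x ab Px.
by have := none a; rewrite def_x eq_sym ab setUC Px.
Qed.

Lemma partner_neq P x : pairing P -> partner P x != x.
Proof.
move=> PP; have : [set x; partner P x] \in P by rewrite pairing_mem.
case/andP: PP => _ /forall_inP H /H.
by apply: contraTneq => ->; rewrite setUid cards1.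
Qed.

Lemma partnerK P : pairing P -> involutive (partner P).
Proof.
move=> PP x; apply/esym/eqP; rewrite -(pairing_mem _ _ PP) setUC.
by rewrite (pairing_mem _ _ PP).
Qed.

Lemma pairs_partner P : pairing P -> pairs (partner P) = P.
Proof.
move=> PP; apply/setP=> B; apply/imsetP/idP => [[x _ ->]|BP].
  by rewrite pairing_mem.
case/andP: (PP) => _ /forall_inP /(_ _ BP) /cards2P[a [b [ab defB]]].
by exists a => //; move: BP; rewrite defB pairing_mem // => /eqP ->.
Qed.

Section OfInvolution.
Variable p : W -> W.
Hypotheses (pK : involutive p) (p_neq : forall x, p x != x).

Lemma pairs_pairing : pairing (pairs p).
Proof.
apply/andP; split; last first.
  by apply/forall_inP=> B /imsetP[x _ ->]; rewrite cards2 (eq_sym x) p_neq.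
apply/and3P; split.
- apply/eqP/setP=> x; rewrite inE; apply/bigcupP.
  by exists [set x; p x]; [exact: imset_f | exact: set21].
- apply/trivIsetP=> _ _ /imsetP[x _ ->] /imsetP[y _ ->].
  apply: contraR; rewrite -setI_eq0 => /set0Pn[z].
  by rewrite !inE => /andP[]/orP[]/eqP -> /orP[]/eqP => [->|->|<-|/(inv_inj pK) ->];
    rewrite ?pK // setUC.
- apply/imsetP=> [[x _ /setP/(_ x)]]; by rewrite !inE eqxx.
Qed.

Lemma partner_pairs : partner (pairs p) =1 p.
Proof.
move=> x; apply/esym/eqP; rewrite -(pairing_mem _ _ pairs_pairing).
exact: imset_f.
Qed.

End OfInvolution.

(** * The blocks inside one row *)

(** For f the inclusion of the upper or of the lower row, [induced P] matches
    the points that P pairs inside that row and fixes the others; both rows are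
    treated at once. *)
Section Induced.
Variables (T : finType) (f : T -> W).
Hypothesis f_inj : injective f.

Definition induced P : {ffun T -> T} :=
  [ffun x => odflt x [pick y | partner P (f x) == f y]].

Lemma inducedE P x y : partner P (f x) = f y -> induced P x = y.
Proof.
rewrite ffunE => Pxy; case: pickP => [z /eqP|/(_ y)] /=; rewrite Pxy ?eqxx //.
by move/f_inj.
Qed.

Lemma induced_out P x : (forall y, partner P (f x) != f y) -> induced P x = x.
Proof. by rewrite ffunE => out; case: pickP => // y; rewrite (negPf (out y)). Qed.

Lemma induced_neq P x : induced P x != x -> partner P (f x) = f (induced P x).
Proof. by rewrite ffunE; case: pickP => [y /eqP //|_]; rewrite /= eqxx. Qed.

Lemma induced_fixed P x : pairing P ->
  (induced P x == x) = [forall y, partner P (f x) != f y].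
Proof.
move=> PP; apply/eqP/forallP => [Px y | /induced_out //].
apply/eqP=> /[dup] Pxy /inducedE; rewrite Px => xy.
by move: (partner_neq (f x) PP); rewrite Pxy xy eqxx.
Qed.

Lemma inducedK P : pairing P -> involutive (induced P).
Proof.
move=> PP x; case: (eqVneq (induced P x) x) => [Px|/induced_neq Px].
  by rewrite !Px.
by apply: inducedE; rewrite -Px partnerK.
Qed.

(** The left-hand side compares the graphs that define the R-classes and the
    L-classes. *)
Lemma induced_trace P Q : pairing P -> pairing Q ->
  ([set e : {set T} | f @: e \in P] == [set e : {set T} | f @: e \in Q])
  = (induced P == induced Q).
Proof.
have trace R x y : pairing R ->
    (f @: [set x; y] \in R) = (partner R (f x) == f y).
  by move=> RP; rewrite imsetU1 imset_set1 pairing_mem // eq_sym.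
move=> PP QP; apply/eqP/eqP => [/setP PQ | PQ].
  apply/ffunP=> x; rewrite !ffunE; congr odflt; apply: eq_pick => y.
  by have := PQ [set x; y]; rewrite !inE !trace.
have sub R S : pairing R -> pairing S -> induced R = induced S ->
    forall e : {set T}, f @: e \in R -> f @: e \in S.
  move=> RP SP RS e eR; have /andP[_ /forall_inP /(_ _ eR)] := RP.
  rewrite card_imset // => /cards2P[x [y [xy def_e]]].
  rewrite def_e !trace // in eR *; apply/eqP.
  have Rx := inducedE (eqP eR).
  by rewrite induced_neq -RS Rx // eq_sym.
apply/setP=> e; rewrite !inE.
by apply/idP/idP; apply: sub.
Qed.

End Induced.
End Pairings.

(** * Brauer diagrams and their squares *)

Section Idempotents.
Variable n : nat.
Implicit Types (al be : {set {set vertex n}}) (u v : {ffun 'I_n -> 'I_n}).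

Notation up := (@inl 'I_n 'I_n : 'I_n -> vertex n).
Notation low := (@inr 'I_n 'I_n : 'I_n -> vertex n).

Lemma up_inj : injective up. Proof. by move=> x y []. Qed.
Lemma low_inj : injective low. Proof. by move=> x y []. Qed.

Definition upper al := induced up al.
Definition lower al := induced low al.

Lemma brauerE al : (al \in brauer n) = pairing al.
Proof. by rewrite inE. Qed.

Lemma upper_fixed al x : pairing al -> upper al x = x ->
  exists y, partner al (up x) = low y.
Proof.
move=> PP /eqP; rewrite induced_fixed; [|exact: up_inj|done].
by move/forallP; case: (partner _ _) => [z /(_ z)|y _]; [rewrite eqxx | exists y].
Qed.

Lemma lower_fixed al y : pairing al -> lower al y = y ->
  exists x, partner al (low y) = up x.
Proof.
move=> PP /eqP; rewrite induced_fixed; [|exact: low_inj|done].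
by move/forallP; case: (partner _ _) => [x _|z /(_ z)]; [exists x | rewrite eqxx].
Qed.

Lemma transversal_fixed al x y : pairing al -> partner al (up x) = low y ->
  upper al x = x /\ lower al y = y.
Proof.
move=> PP xy; have yx : partner al (low y) = up x by rewrite -xy partnerK.
by split; apply: induced_out => z; rewrite ?xy ?yx.
Qed.

Lemma rank_upper al : pairing al -> rank al = #|fixed (upper al)|.
Proof.
move=> PP; pose g x : {set vertex n} := [set up x; partner al (up x)].
rewrite -(@card_in_imset _ _ g (fixed (upper al))) => [|x x'].
  congr #|pred_of_set _|; apply/setP=> B; rewrite inE.
  apply/and3P/imsetP => [[BP /existsP[i iB] /existsP[j jB]] | [x]].
    exists i.
      rewrite inE; apply/eqP.
      have [w _ defB] : exists2 w, w \in [set: vertex n] & B = [set w; partner al w].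
        by move: BP; rewrite -{1}(pairs_partner PP) => /imsetP[w _ ->]; exists w.
      apply: (@proj1 _ (lower al j = j)); apply: transversal_fixed => //.
      move: iB jB; rewrite defB => /set2P[] iw /set2P[] jw.
      - by move: iw; rewrite -jw.
      - by rewrite iw -jw.
      - by rewrite iw partnerK // -jw.
      - by move: iw; rewrite -jw.
    have [w _ defB] : exists2 w, w \in [set: vertex n] & B = [set w; partner al w].
      by move: BP; rewrite -{1}(pairs_partner PP) => /imsetP[w _ ->]; exists w.
    rewrite /g; move: iB; rewrite defB => /set2P[]-> //.
    by rewrite partnerK // setUC.
  rewrite inE => /eqP/(upper_fixed PP)[y xy] ->; rewrite /g xy; split.
  - by rewrite pairing_mem // xy.
  - by apply/existsP; exists x; rewrite set21.
  - by apply/existsP; exists y; rewrite set22.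
rewrite !inE => /eqP/(upper_fixed PP)[y xy] /eqP/(upper_fixed PP)[y' xy'].
by rewrite /g xy xy' => /set2_eq[][] // [].
Qed.

Lemma card_fixed_lower al : pairing al ->
  #|fixed (lower al)| = #|fixed (upper al)|.
Proof.
move=> PP; rewrite -[LHS](card_imset _ low_inj) -[RHS](card_imset _ up_inj).
rewrite -[RHS](card_imset _ (inv_inj (partnerK PP))).
congr #|pred_of_set _|; apply/setP=> w; apply/imsetP/imsetP.
  case=> y + ->; rewrite inE => /eqP/(lower_fixed PP)[x yx].
  have xy : partner al (up x) = low y by rewrite -yx partnerK.
  exists (up x); rewrite ?xy // imset_f // inE.
  by have [-> _] := transversal_fixed PP xy.
case=> _ /imsetP[x + ->]; rewrite inE => /eqP/(upper_fixed PP)[y xy] ->.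
by exists y; rewrite // inE; have [_ ->] := transversal_fixed PP xy.
Qed.

Lemma Gamma_sym al : symmetric (Gamma al al).
Proof. by move=> a b; rewrite /Gamma /= setUC. Qed.

Lemma Gamma_top al w : pairing al ->
  Gamma al al (embed_top w) (embed_top (partner al w)).
Proof.
move=> PP; rewrite /Gamma /= inE; apply/orP; left; apply/imsetP.
by exists [set w; partner al w]; rewrite ?pairing_mem // imsetU1 imset_set1.
Qed.

Lemma Gamma_bot al w : pairing al ->
  Gamma al al (embed_bot w) (embed_bot (partner al w)).
Proof.
move=> PP; rewrite /Gamma /= inE; apply/orP; right; apply/imsetP.
by exists [set w; partner al w]; rewrite ?pairing_mem // imsetU1 imset_set1.
Qed.

Lemma Gamma_inv al a b : pairing al -> Gamma al al a b -> exists w,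
  (a = embed_top w /\ b = embed_top (partner al w)) \/
  (a = embed_bot w /\ b = embed_bot (partner al w)).
Proof.
move=> PP; rewrite /Gamma /= inE => /orP[]/imsetP[B];
  rewrite -{1}(pairs_partner PP) => /imsetP[w _ ->];
  rewrite imsetU1 imset_set1 => /set2_eq[][-> ->];
  [exists w | exists (partner al w) | exists w | exists (partner al w)];
  rewrite ?partnerK; auto.
Qed.

(** The classes of al are the pairs {w, partner w}. *)
Lemma idem_connect al : pairing al ->
  (bmul al al == al) <->
  (forall w w', connect (Gamma al al) (inl w) (inl w')
                = (w' == w) || (w' == partner al w)).
Proof.
move=> PP; split=> [/eqP idem w w' | conn].
  set E := [set y in [set: vertex n] | connect (Gamma al al) (inl w) (inl y)].
  have : E \in al by rewrite -idem; apply/imsetP; exists w.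
  have wE : w \in E by rewrite !inE connect0.
  rewrite -{1}(pairs_partner PP) => /imsetP[z _ defE].
  have -> : connect (Gamma al al) (inl w) (inl w') = (w' \in E) by rewrite !inE.
  move: wE; rewrite defE => /set2P[]->; rewrite !inE ?partnerK //.
  exact: orbC.
have conn_class w : [set w' in [set: vertex n] |
    connect (Gamma al al) (inl w) (inl w')] = [set w; partner al w].
  by apply/setP=> w'; rewrite !inE conn.
rewrite -[X in _ == X](pairs_partner PP); apply/eqP/setP=> B.
by apply/imsetP/imsetP=> [][w _ ->]; exists w; rewrite ?conn_class.
Qed.

(** The middle row of the product graph: the upper blocks of the second factor
    are the edges of u, the lower blocks of the first are those of v. *)
Lemma linked_Gamma al x y : pairing al -> linked (upper al) (lower al) x y ->
  connect (Gamma al al) (inr x) (inr y).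
Proof.
move=> PP /connectP[q]; elim: q x => [|z q IH] x /= => [_ ->|]; first exact: connect0.
case/andP=> xz /IH h /h; apply: connect_trans; case/orP: xz => /eqP <-.
  have [->|ux] := eqVneq (upper al x) x; first exact: connect0.
  by have := Gamma_bot (up x) PP; rewrite (induced_neq ux) => /connect1.
have [->|vx] := eqVneq (lower al x) x; first exact: connect0.
by have := Gamma_top (low x) PP; rewrite (induced_neq vx) => /connect1.
Qed.

(** * From separated pairs to idempotents *)

(** The only candidate for an idempotent with upper blocks u and lower blocks v:
    its transversals join the two ends of each path. *)
Definition joined u v (w : vertex n) : vertex n :=
  match w with
  | inl x => if u x == x then low (far u v x) else up (u x)
  | inr y => if v y == y then up (far v u y) else low (v y)
  end.

Section Joined.
Variables u v : {ffun 'I_n -> 'I_n}.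
Hypotheses (uK : involutive u) (vK : involutive v) (sep : separated u v).

Let sep' : separated v u. Proof. by rewrite separatedC. Qed.

Lemma joinedK : involutive (joined u v).
Proof.
case=> [x|y] /=; case: eqP => [fx|fx] /=.
- by have [-> _] := far_spec uK vK sep fx; rewrite eqxx farK.
- by rewrite uK eq_sym; case: eqP.
- by have [-> _] := far_spec vK uK sep' fx; rewrite eqxx farK.
- by rewrite vK eq_sym; case: eqP.
Qed.

Lemma joined_neq w : joined u v w != w.
Proof.
by case: w => [x|y] /=; case: ifP => // /negbT; apply: contraNneq => [[->]].
Qed.

Lemma upper_joined al : partner al =1 joined u v -> upper al = u.
Proof.
move=> E; apply/ffunP=> x; case: (eqVneq (u x) x) => [ux|ux].
  by rewrite ux; apply: induced_out => y; rewrite E /= ux eqxx.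
by apply: inducedE; [exact: up_inj | rewrite E /= (negPf ux)].
Qed.

Lemma lower_joined al : partner al =1 joined u v -> lower al = v.
Proof.
move=> E; apply/ffunP=> x; case: (eqVneq (v x) x) => [vx|vx].
  by rewrite vx; apply: induced_out => y; rewrite E /= vx eqxx.
by apply: inducedE; [exact: low_inj | rewrite E /= (negPf vx)].
Qed.

(** Blocks are connected in the product graph by construction.  For the converse,
    label an outer vertex by its block, and a middle vertex on a path by the
    transversal attached to the end of this path that u fixes: this label is
    constant along edges, so connected outer vertices are in the same block. *)
Lemma joined_idem al : pairing al -> partner al =1 joined u v ->
  bmul al al == al.
Proof.
move=> PP E; apply/(idem_connect PP) => w w'.
have mid x y : linked u v x y -> connect (Gamma al al) (inr x) (inr y).
  by move=> lxy; apply: linked_Gamma; rewrite ?(upper_joined E) ?(lower_joined E).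
have trans x y : u x = x -> y = far u v x ->
    connect (Gamma al al) (inl (up x)) (inl (low y)).
  move=> ux ->; have [vf lxf] := far_spec uK vK sep ux.
  have := Gamma_top (up x) PP; have := Gamma_bot (up x) PP.
  rewrite E /= ux eqxx => b t.
  apply: connect_trans (connect1 t) (connect_trans _ (connect1 b)).
  by apply: mid; rewrite linked_sym.
have csym := sym_connect_sym (@Gamma_sym al).
apply/idP/orP => [|[]/eqP ->]; last 2 first.
- exact: connect0.
- rewrite E; case: w => [x|y] /=; case: eqP => [fx|fx].
  + exact: trans.
  + by have := Gamma_top (up x) PP; rewrite E /=; case: eqP => // _ /connect1.
  + rewrite csym; apply: trans; last by rewrite farK.
    by have [] := far_spec vK uK sep' fx.
  + by have := Gamma_bot (low y) PP; rewrite E /=; case: eqP => // _ /connect1.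
pose block w : {set vertex n} := [set w; partner al w].
pose label (a : vertex3 n) := match a with
  | inl w => block w
  | inr m => if [pick x in fixed u | linked u v m x] is Some x then block (up x) else set0
  end.
have label_mid m x : u x = x -> linked u v m x -> label (inr m) = block (up x).
  move=> ux lmx /=; case: pickP => [z /andP[]|/(_ x)]; last by rewrite inE ux eqxx lmx.
  rewrite inE => /eqP uz lmz; congr (block (up _)).
  move/separatedP: sep; apply; last by left.
  by apply: linked_trans lmx; rewrite (linked_sym uK vK).
have label_linked m m' : linked u v m m' -> label (inr m) = label (inr m').
  move=> lmm' /=; congr (if _ is Some x then _ else _); apply: eq_pick => x /=.
  by congr (_ && _); apply/idP/idP; apply: linked_trans; rewrite // linked_sym.
have blockE w1 : block (partner al w1) = block w1.
  by rewrite /block partnerK // setUC.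
have label_edge a b : Gamma al al a b -> label a = label b.
  have blockU x : block (joined u v (up x)) = block (up x) by rewrite -E blockE.
  have blockL y : block (joined u v (low y)) = block (low y) by rewrite -E blockE.
  have label_near x : u x = x -> label (inr x) = block (up x).
    by move=> ux; apply: label_mid => //; apply: linked_refl.
  have label_far x : u x = x -> label (inr (far u v x)) = block (up x).
    move=> ux; have [_ lf] := far_spec uK vK sep ux.
    by apply: label_mid; rewrite // linked_sym.
  case/(Gamma_inv PP)=> [[x|y]] [] [-> ->]; rewrite E.
  - have := blockU x; rewrite /joined; case: eqP => [ux _|_] //.
    by rewrite label_far.
  - have := blockU x; rewrite /joined; case: eqP => [ux blockx|_ _].
      by rewrite label_near // -blockx.
    exact/label_linked/linked_u.
  - rewrite /joined; case: eqP => [vy|_]; last exact/label_linked/linked_v.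
    have [uf _] := far_spec vK uK sep' vy.
    by rewrite /= -(label_far _ uf) farK.
  - have := blockL y; rewrite /joined; case: eqP => [vy blocky|_] //.
    have [uf _] := far_spec vK uK sep' vy.
    by rewrite [RHS](label_near _ uf) blocky.
have label_connect a b : connect (Gamma al al) a b -> label a = label b.
  case/connectP=> q; elim: q a => [|c q IH] a /= => [_ -> //|].
  by case/andP=> /label_edge -> /IH h /h.
move/label_connect=> /= blockww'; apply/orP.
by rewrite -in_set2 -/(block w) blockww' set21.
Qed.

End Joined.

(** * From idempotents to separated pairs *)

(** Each end of a path in the middle row is adjacent to an outer vertex: a lower
    one at a fixed point of u ([exit_low]), an upper one at a fixed point of v
    ([exit_up]).  The outer vertices at the two ends of a path form a block of
    the square ([relink]), so of the idempotent itself. *)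
Section Idempotent.
Variable al : {set {set vertex n}}.
Hypotheses (PP : pairing al) (idem : bmul al al == al).

Let conn := proj1 (idem_connect PP) idem.
Let upK := inducedK up_inj PP.
Let lowK := inducedK low_inj PP.

Let exit_low a : upper al a = a -> exists2 a', partner al (up a) = low a' &
  connect (Gamma al al) (inr a) (inl (low a')).
Proof.
move=> /(upper_fixed PP)[a' aa']; exists a' => //.
by have := Gamma_bot (up a) PP; rewrite aa' => /connect1.
Qed.

Let exit_up a : lower al a = a -> exists2 a', partner al (low a) = up a' &
  connect (Gamma al al) (inr a) (inl (up a')).
Proof.
move=> /(lower_fixed PP)[a' aa']; exists a' => //.
by have := Gamma_top (low a) PP; rewrite aa' => /connect1.
Qed.

Let relink a b c d : linked (upper al) (lower al) a b ->
  connect (Gamma al al) (inr a) (inl c) -> connect (Gamma al al) (inr b) (inl d) ->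
  (d == c) || (d == partner al c).
Proof.
move=> lab ac bd; rewrite -conn; apply: (@connect_trans _ _ (inr a)).
  by rewrite (sym_connect_sym (@Gamma_sym al)).
exact: connect_trans (linked_Gamma PP lab) bd.
Qed.

(** Otherwise the two ends would yield a lower (or upper) block made of vertices
    that belong to transversals. *)
Lemma idem_separated : separated (upper al) (lower al).
Proof.
have pI := inv_inj (partnerK PP).
apply/separatedP=> a b lab [] [fa fb].
  have [[a' aa' ca] [b' bb' cb]] := (exit_low fa, exit_low fb).
  case/orP: (relink lab ca cb) => /eqP E; last by move: E; rewrite -aa' partnerK.
  by have /pI[] : partner al (up a) = partner al (up b) by rewrite aa' bb' E.
have [[a' aa' ca] [b' bb' cb]] := (exit_up fa, exit_up fb).
case/orP: (relink lab ca cb) => /eqP E; last by move: E; rewrite -aa' partnerK.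
by have /pI[] : partner al (low a) = partner al (low b) by rewrite aa' bb' E.
Qed.

(** The transversal through the upper vertex x continues, in the square, along
    the path of x, and comes out at the opposite end. *)
Lemma idem_partner : partner al =1 joined (upper al) (lower al).
Proof.
have sep := idem_separated.
have through x : upper al x = x ->
    partner al (up x) = low (far (upper al) (lower al) x).
  move=> ux; have [vf lxf] := far_spec upK lowK sep ux.
  have [[y xy cx] [x' yx' cf]] := (exit_low ux, exit_up vf).
  case/orP: (relink lxf cx cf) => /eqP; first by [].
  by rewrite -yx' => /(inv_inj (partnerK PP)) ->.
case=> [x|y]; rewrite /joined; case: eqP => [fw|/eqP fw].
- exact: through.
- exact: induced_neq.
- have [x yx] := lower_fixed PP fw.
  have xy : partner al (up x) = low y by rewrite -yx partnerK.
  have [ux _] := transversal_fixed PP xy.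
  have [->] : low y = low (far (upper al) (lower al) x) by rewrite -through.
  by rewrite farK // -through // partnerK.
- exact: induced_neq.
Qed.

End Idempotent.

(** * Counting idempotents *)

Definition assemble u v := pairs (joined u v).

Lemma assembleK al : pairing al -> bmul al al == al ->
  assemble (upper al) (lower al) = al.
Proof.
move=> PP idem; rewrite -[RHS](pairs_partner PP).
by apply/eq_imset => w; rewrite idem_partner.
Qed.

Section Assemble.
Variables u v : {ffun 'I_n -> 'I_n}.
Hypotheses (uI : u \in invols [set: 'I_n]) (vI : v \in invols [set: 'I_n]).
Hypothesis sep : separated u v.

Let uK : involutive u. Proof. exact/involsT. Qed.
Let vK : involutive v. Proof. exact/involsT. Qed.
Let partner_assemble : partner (assemble u v) =1 joined u v.
Proof. exact: (partner_pairs (joinedK uK vK sep) (@joined_neq u v)). Qed.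

Lemma assemble_pairing : pairing (assemble u v).
Proof. exact: (pairs_pairing (joinedK uK vK sep) (@joined_neq u v)). Qed.

Lemma assemble_idem : bmul (assemble u v) (assemble u v) == assemble u v.
Proof. exact: (joined_idem uK vK sep assemble_pairing). Qed.

Lemma upper_assemble : upper (assemble u v) = u.
Proof. exact: upper_joined partner_assemble. Qed.

Lemma lower_assemble : lower (assemble u v) = v.
Proof. exact: lower_joined partner_assemble. Qed.

End Assemble.

Lemma upper_invols al : pairing al -> upper al \in invols [set: 'I_n].
Proof. by move=> PP; apply/involsT/inducedK => //; apply: up_inj. Qed.

Lemma lower_invols al : pairing al -> lower al \in invols [set: 'I_n].
Proof. by move=> PP; apply/involsT/inducedK => //; apply: low_inj. Qed.

Lemma card_idem_upper u : u \in invols [set: 'I_n] ->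
  #|[set al in brauer n | (bmul al al == al) && (upper al == u)]|
  = a_ n #|fixed u|.
Proof.
move=> uI; have := card_separated uI; rewrite setTI cardsT card_ord => <-.
rewrite -[RHS](@card_in_imset _ _ (assemble u)) => [|v v'].
  congr #|pred_of_set _|; apply/setP=> al; rewrite inE brauerE.
  apply/and3P/imsetP => [[PP idem /eqP <-]|[v + ->]].
    exists (lower al); last by rewrite assembleK.
    by rewrite inE lower_invols // idem_separated.
  rewrite inE => /andP[vI sep]; split; last by rewrite upper_assemble.
    exact: assemble_pairing.
  exact: assemble_idem.
rewrite [v \in _]inE [v' \in _]inE => /andP[vI sv] /andP[v'I sv'] E.
by rewrite -(lower_assemble uI vI sv) E lower_assemble.
Qed.

Lemma card_idem_lower v : v \in invols [set: 'I_n] ->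
  #|[set al in brauer n | (bmul al al == al) && (lower al == v)]|
  = a_ n #|fixed v|.
Proof.
move=> vI; have := card_separated vI; rewrite setTI cardsT card_ord => <-.
rewrite -[RHS](@card_in_imset _ _ (assemble^~ v)) => [|u u'].
  congr #|pred_of_set _|; apply/setP=> al; rewrite inE brauerE.
  apply/and3P/imsetP => [[PP idem /eqP <-]|[u + ->]].
    exists (upper al); last by rewrite assembleK.
    by rewrite inE upper_invols // separatedC idem_separated.
  rewrite inE separatedC => /andP[uI sep]; split; last by rewrite lower_assemble.
    exact: assemble_pairing.
  exact: assemble_idem.
rewrite [u \in _]inE [u' \in _]inE => /andP[uI su] /andP[u'I su'] E.
rewrite separatedC in su; rewrite separatedC in su'.
by rewrite -(upper_assemble uI vI su) E upper_assemble.
Qed.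

Lemma idem_count_Rclass al : pairing al ->
  idem_count (Rclass al) = a_ n #|fixed (upper al)|.
Proof.
move=> PP; rewrite -card_idem_upper ?upper_invols //; congr #|pred_of_set _|.
apply/setP=> be; rewrite [in LHS]inE [in LHS]inE [in RHS]inE brauerE.
case: (boolP (pairing be)) => //= BP.
by rewrite andbC -(induced_trace up_inj BP PP).
Qed.

Lemma idem_count_Lclass al : pairing al ->
  idem_count (Lclass al) = a_ n #|fixed (lower al)|.
Proof.
move=> PP; rewrite -card_idem_lower ?lower_invols //; congr #|pred_of_set _|.
apply/setP=> be; rewrite [in LHS]inE [in LHS]inE [in RHS]inE brauerE.
case: (boolP (pairing be)) => //= BP.
by rewrite andbC -(induced_trace low_inj BP PP).
Qed.

(** Classify by u; the number of u with r fixed points is rho. *)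
Lemma idem_count_Dclass r : ~~ odd (n - r) ->
  idem_count (Dclass n r) = rho n r * a_ n r.
Proof.
move=> ev; rewrite /idem_count -sum1_card.
pose D := [set u in invols [set: 'I_n] | #|fixed u| == r].
rewrite (partition_big upper (mem D))
  => [|al]; last first.
  rewrite inE [_ \in Dclass n r]inE brauerE => /andP[/andP[PP rk] _].
  suff : upper al \in D by [].
  by rewrite inE upper_invols //= -rank_upper.
rewrite (eq_bigr (fun=> a_ n r)) => [|u].
  rewrite sum_nat_const card_invols_fixed card_ord // /rho.
  by have := odd_double_half (n - r); rewrite (negPf ev) add0n => ->.
move=> uD; have : u \in D := uD; rewrite inE => /andP[uI /eqP fu].
rewrite -fu -card_idem_upper // -[RHS]sum1_card; apply: eq_bigl => al.
rewrite [in RHS]inE [al \in [set _ in _ | _]]inE [al \in Dclass n _]inE brauerE.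
case: (boolP (pairing al)) => //= PP; have [ual|_] := eqVneq (upper al) u; last by rewrite !andbF.
by rewrite !andbT rank_upper // ual eqxx.
Qed.

(** The parity of n - r is that of the number of points that u moves. *)
Lemma rank_Iset al : pairing al -> rank al \in Iset n.
Proof.
move=> PP; rewrite rank_upper // mem_filter mem_iota add0n /= ltnS.
have le_n : #|fixed (upper al)| <= n by rewrite -[X in _ <= X]card_ord max_card.
rewrite le_n andbT oddB // -{1}[n]card_ord -cardsT.
have uK : involutive (upper al) by apply/involsT/upper_invols.
rewrite (@odd_card_fixed _ _ [set: 'I_n] uK) => [|x _]; last by rewrite inE.
by rewrite setTI addbb.
Qed.

Lemma idem_count_brauer :
  idem_count (brauer n) = \sum_(s <- Iset n) idem_count (Dclass n s).
Proof.
rewrite /idem_count (eq_bigr (fun s =>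
    \sum_(al in [set al in brauer n | bmul al al == al]) (rank al == s))).
  rewrite exchange_big /= -sum1_card; apply: eq_bigr => al.
  rewrite inE brauerE => /andP[PP _].
  rewrite (bigD1_seq (rank al)) ?rank_Iset ?filter_uniq ?iota_uniq //= eqxx.
  by rewrite big1 // => s /negPf; rewrite eq_sym => ->.
move=> s _; rewrite -sum1_card [RHS]big_mkcond [LHS]big_mkcond /=.
apply: eq_bigr => al _; rewrite inE [al \in Dclass n s]inE.
rewrite [in RHS]inE; case: (al \in brauer n) => //=.
by case: (rank al == s); case: (bmul al al == al).
Qed.

End Idempotents.

Lemma dfact_double k : dfact k.*2.-1 * (2 ^ k * k`!) = (k.*2)`!.
Proof.
elim: k => // k IH; rewrite doubleS [RHS]factS [(k.*2.+1)`!]factS -IH.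
have -> : dfact k.*2.+2.-1 = k.*2.+1 * dfact k.*2.-1 by case: k {IH} => [|k].
rewrite expnS factS -doubleS -[k.+1.*2]muln2; ring.
Qed.

Lemma rho_fact r k : rho (r + 2 * k) r * (2 ^ k * k`! * r`!) = (r + 2 * k)`!.
Proof.
rewrite /rho addKn mul2n doubleK mulnA -(mulnA 'C(_, _)) dfact_double.
have <- := bin_fact (leq_addr k.*2 r).
by rewrite addKn -mulnA [in RHS](mulnC r`!).
Qed.

Theorem theorem30 (n r : nat) (hr : r \in Iset n) :
  [/\
      forall k : nat, n = r + 2 * k ->
        rho n r * (2 ^ k * k`! * r`!) = n`!,
      forall al : {set {set vertex n}}, al \in Dclass n r ->
        idem_count (Rclass al) = a_ n r /\ idem_count (Lclass al) = a_ n r,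
      idem_count (Dclass n r) = rho n r * a_ n r
    & idem_count (brauer n) = \sum_(s <- Iset n) rho n s * a_ n s].
Proof.
have even_Iset s : s \in Iset n -> ~~ odd (n - s) by rewrite mem_filter => /andP[].
split=> [k ->|al||]; first exact: rho_fact.
- rewrite inE brauerE => /andP[PP /eqP <-].
  rewrite idem_count_Rclass // idem_count_Lclass // card_fixed_lower //.
  by rewrite rank_upper.
- exact/idem_count_Dclass/even_Iset.
- rewrite idem_count_brauer big_seq [RHS]big_seq.
  by apply: eq_bigr => s /even_Iset/idem_count_Dclass.
Qed.
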